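(* Let $H$ be a separable infinite-dimensional complex Hilbert space. The set of cyclic unitary operators on $H$ is dense, in the operator norm topology, in the set of all unitary operators on $H$.
   Context: An operator $T\in L(H)$ is cyclic if there is $x\in H$ such that the linear span of $\{x,Tx,T^2x,\dots\}$ is norm-dense in $H$. *)

(* Defs.v *)
From HB Require Import structures.
From mathcomp Require Import all_boot all_order all_algebra.
From mathcomp Require Import reals complex.
Set Implicit Arguments. Unset Strict Implicit. Unset Printing Implicit Defensive.
Import Order.TTheory GRing.Theory Num.Theory.
Local Open Scope ring_scope.

Section Hilbert.
Variables (R : realType) (H : lmodType R[i]) (ip : H -> H -> R[i]).

Definition hnorm (x : H) : R := Num.sqrt (complex.Re (ip x x)).

Definition inner_product_axioms : Prop :=
  [/\ (forall (a : R[i]) (x y z : H), ip (a *: x + y) z = a * ip x z + ip y z),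
      (forall x y : H, ip y x = conjc (ip x y)),
      (forall x : H, 0 <= complex.Re (ip x x)) &
      (forall x : H, ip x x = 0 -> x = 0)].

Definition complete_space : Prop :=
  forall u : nat -> H,
    (forall e : R, 0 < e -> exists N : nat, forall m n : nat,
        (N <= m)%N -> (N <= n)%N -> hnorm (u m - u n) < e) ->
    exists l : H, forall e : R, 0 < e -> exists N : nat, forall n : nat,
        (N <= n)%N -> hnorm (u n - l) < e.

Definition separable_space : Prop :=
  exists d : nat -> H, forall (x : H) (e : R), 0 < e ->
    exists n : nat, hnorm (x - d n) < e.

Definition infinite_dimensional : Prop :=
  forall n : nat, exists v : 'I_n -> H,
    forall c : 'I_n -> R[i], \sum_(i < n) c i *: v i = 0 -> forall i, c i = 0.

Definition hilbert_space : Prop :=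
  inner_product_axioms /\ complete_space.

Definition linear_op (T : H -> H) : Prop :=
  forall (a : R[i]) (x y : H), T (a *: x + y) = a *: T x + T y.

Definition bounded_op (T : H -> H) : Prop :=
  exists M : R, forall x : H, hnorm (T x) <= M * hnorm x.

Definition unitary (U : H -> H) : Prop :=
  [/\ linear_op U, bounded_op U &
      exists V : H -> H,
        [/\ (forall x y : H, ip (U x) y = ip x (V y)),
            (forall x : H, V (U x) = x) &
            (forall x : H, U (V x) = x)]].

Definition cyclic_op (T : H -> H) : Prop :=
  exists x : H, forall (y : H) (e : R), 0 < e ->
    exists (n : nat) (c : 'I_n -> R[i]),
      hnorm (y - \sum_(i < n) c i *: iter i T x) < e.

(* operator-norm bound ||A|| < e, written out: the operator norm is the
   infimum of the constants c with ||Ax|| <= c ||x|| for all x *)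
Definition opnorm_lt (A : H -> H) (e : R) : Prop :=
  exists c : R, c < e /\ forall x : H, hnorm (A x) <= c * hnorm x.

End Hilbert.

(* Main.v *)
Require Import Defs.
From HB Require Import structures.
From mathcomp Require Import all_boot all_order all_algebra.
From mathcomp Require Import boolp classical_sets reals complex.
From mathcomp Require Import ring lra.
Import Order.TTheory GRing.Theory Num.Theory.
Local Open Scope ring_scope.

Set Implicit Arguments.
Unset Strict Implicit.
Unset Printing Implicit Defensive.

(** Every self-adjoint contraction [A] has a sign [S], a self-adjoint involution
    commuting with everything self-adjoint that commutes with [A], such that [2 A - S] is again a
    contraction.  Iterating [A := 2 A - S] on the real and imaginary parts of the
    unitary [U] expands both in base 2 with commuting signs as digits; truncating
    gives an operator [C] close to [U] such that every vector is a finite sum of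
    eigenvectors of the normal operator [C].  By separability and Gram-Schmidt there
    is an orthonormal basis [e] of eigenvectors of [C], whose eigenvalues are close to
    the unit circle.  Moving them to pairwise distinct unit numbers yields a diagonal
    unitary [V] close to [U]; it is cyclic with cyclic vector [sum 2^-k e_k], since the
    ergodic averages of [conj mu_m * V] applied to this vector tend to a multiple of
    [e_m]. *)

Local Notation "x %:C" := (real_complex _ x) (format "x %:C") : ring_scope.
Local Notation cabs := ComplexField.Normc.normc.
Local Notation cabsM := ComplexField.Normc.normcM.
Local Notation Re := complex.Re.

(** * Complex modulus *)

Section ComplexModulus.
Variable R : realType.
Implicit Types (a b : R[i]) (r : R).

Lemma cabs_sqr a : cabs a ^+ 2 = Re a ^+ 2 + complex.Im a ^+ 2.
Proof. by case: a => x y /=; rewrite sqr_sqrtr // addr_ge0 // sqr_ge0. Qed.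

Lemma cabs_ge0 a : 0 <= cabs a.
Proof. by case: a => x y /=; rewrite sqrtr_ge0. Qed.

Lemma cabs_real r : cabs r%:C = `|r|.
Proof. by rewrite /= expr0n /= addr0 sqrtr_sqr. Qed.

Lemma mulc_conj a : a * conjc a = (cabs a ^+ 2)%:C.
Proof.
rewrite cabs_sqr; case: a => x y; apply/eqP; rewrite eq_complex /=.
by apply/andP; split; apply/eqP; ring.
Qed.

Lemma cabs_conj a : cabs (conjc a) = cabs a.
Proof. by case: a => x y /=; rewrite sqrrN. Qed.

Lemma cabs_eq0 a : (cabs a == 0) = (a == 0).
Proof.
apply/eqP/eqP => [/ComplexField.Normc.eq0_normc //|->]; exact: ComplexField.Normc.normc0.
Qed.

Lemma ReD a b : Re (a + b) = Re a + Re b.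
Proof. by case: a b => ? ? [? ?]. Qed.

Lemma ReN a : Re (- a) = - Re a.
Proof. by case: a. Qed.

Lemma Re_conj a : Re (conjc a) = Re a.
Proof. by case: a. Qed.

Lemma conjcD a b : conjc (a + b) = conjc a + conjc b.
Proof. exact: rmorphD. Qed.

Lemma conjcM a b : conjc (a * b) = conjc a * conjc b.
Proof. exact: rmorphM. Qed.

Lemma Re_realM r a : Re (r%:C * a) = r * Re a.
Proof. by case: a => x y /=; rewrite mul0r subr0. Qed.

End ComplexModulus.

(** * Inner product spaces and convergence *)

Section InnerProduct.
Variables (R : realType) (H : lmodType R[i]) (ip : H -> H -> R[i]).
Hypothesis ipax : inner_product_axioms ip.
Local Notation N := (hnorm ip).
Implicit Types (x y z : H) (a b : R[i]).

Lemma ipDl x y z : ip (x + y) z = ip x z + ip y z.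
Proof. by case: ipax => h _ _ _; rewrite -{1}[x]scale1r h mul1r. Qed.

Lemma ip0l z : ip 0 z = 0.
Proof. by apply: (addrI (ip 0 z)); rewrite -ipDl !addr0. Qed.

Lemma ipZl a x z : ip (a *: x) z = a * ip x z.
Proof. by case: ipax => h _ _ _; rewrite -[a *: x]addr0 h ip0l addr0. Qed.

Lemma ipC x y : ip y x = conjc (ip x y).
Proof. by case: ipax. Qed.

Lemma ipNl x z : ip (- x) z = - ip x z.
Proof. by rewrite -scaleN1r ipZl mulN1r. Qed.

Lemma ipDr x y z : ip z (x + y) = ip z x + ip z y.
Proof. by rewrite ipC ipDl conjcD -!ipC. Qed.

Lemma ipNr x z : ip z (- x) = - ip z x.
Proof. by rewrite ipC ipNl rmorphN /= -ipC. Qed.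

Lemma ip0r z : ip z 0 = 0.
Proof. by rewrite ipC ip0l conjc0. Qed.

Lemma ipZr a x z : ip z (a *: x) = conjc a * ip z x.
Proof. by rewrite ipC ipZl conjcM -ipC. Qed.

Definition ipE := (ipDl, ipDr, ipNl, ipNr, ipZl, ipZr, ip0l, ip0r).

Lemma ip_suml (I : Type) (s : seq I) (P : pred I) (F : I -> H) z :
  ip (\sum_(i <- s | P i) F i) z = \sum_(i <- s | P i) ip (F i) z.
Proof. by apply: (big_morph (ip^~ z)) => [x y|]; rewrite ?ipDl ?ip0l. Qed.

Lemma ip_sumr (I : Type) (s : seq I) (P : pred I) (F : I -> H) z :
  ip z (\sum_(i <- s | P i) F i) = \sum_(i <- s | P i) ip z (F i).
Proof. by apply: (big_morph (ip z)) => [x y|]; rewrite ?ipDr ?ip0r. Qed.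

Lemma hnorm_ge0 x : 0 <= N x.
Proof. exact: sqrtr_ge0. Qed.
Hint Resolve hnorm_ge0 : core.

Lemma hnorm_sqr x : N x ^+ 2 = Re (ip x x).
Proof. by rewrite sqr_sqrtr //; case: ipax. Qed.

Lemma ipxx x : ip x x = (N x ^+ 2)%:C.
Proof.
rewrite hnorm_sqr; have := ipC x x; case: (ip x x) => u v [] /eqP.
rewrite -subr_eq0 opprK -mulr2n mulrn_eq0 /= => /eqP -> //.
Qed.

Lemma hnorm_eq0 x : N x = 0 -> x = 0.
Proof. by case: ipax => _ _ _ h n0; apply: h; rewrite ipxx n0 expr0n. Qed.

Lemma hnorm0 : N 0 = 0.
Proof. by rewrite /hnorm ip0l sqrtr0. Qed.

(** Pairing with an arbitrary vector reduces identities between vectors to scalar ones, which [ring]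
    and [field] decide; the tactic [vring] packages this. *)
Lemma ip_ext x y : (forall z, ip x z = ip y z) -> x = y.
Proof.
move=> h; apply/eqP; rewrite -subr_eq0; apply/eqP/hnorm_eq0/eqP.
by rewrite -sqrf_eq0 hnorm_sqr ipDl h -ipDl subrr ip0l.
Qed.

Local Ltac vring := apply: ip_ext => ?; rewrite !ipE; ring.

Lemma hnormD_sqr x y : N (x + y) ^+ 2 = N x ^+ 2 + N y ^+ 2 + 2 * Re (ip x y).
Proof.
rewrite !hnorm_sqr !ipE !ReD (ipC x y) Re_conj; ring.
Qed.

Lemma hnormN x : N (- x) = N x.
Proof. by rewrite /hnorm ipNl ipNr opprK. Qed.

Lemma hnormBC x y : N (x - y) = N (y - x).
Proof. by rewrite -hnormN opprB. Qed.

Lemma hnormB_sqr x y : N (x - y) ^+ 2 = N x ^+ 2 + N y ^+ 2 - 2 * Re (ip x y).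
Proof. by rewrite hnormD_sqr hnormN ipNr ReN mulrN. Qed.

Lemma hnormZ a x : N (a *: x) = cabs a * N x.
Proof.
apply/eqP; rewrite -(eqrXn2 (n := 2)) ?mulr_ge0 ?cabs_ge0 //.
by rewrite hnorm_sqr !ipE mulrA mulc_conj ipxx -rmorphM /= exprMn.
Qed.

Lemma hnormZr (r : R) x : N (r%:C *: x) = `|r| * N x.
Proof. by rewrite hnormZ cabs_real. Qed.

Lemma Re_ip_le x y : Re (ip x y) <= N x * N y.
Proof.
have [x0|xn0] := eqVneq (N x) 0.
  by rewrite (hnorm_eq0 x0) ip0l hnorm0 mul0r.
have xp : 0 < N x by rewrite lt_neqAle eq_sym xn0 /=.
(* Cauchy-Schwarz follows by expanding this square and dividing by [N x * N y]. *)
have := sqr_ge0 (N ((N y)%:C *: x - (N x)%:C *: y)).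
rewrite hnormB_sqr !hnormZr !ger0_norm // !ipE conjc_real !Re_realM.
have [y0|yn0] := eqVneq (N y) 0.
  by rewrite (hnorm_eq0 y0) ip0r hnorm0 mulr0.
have yp : 0 < N y by rewrite lt_neqAle eq_sym yn0 /=.
have xy := mulr_gt0 xp yp.
move=> h; rewrite -(ler_pM2l xy); nra.
Qed.

Lemma hnormD x y : N (x + y) <= N x + N y.
Proof.
rewrite -(ler_pXn2r (n := 2)) ?nnegrE ?addr_ge0 //.
by rewrite hnormD_sqr; have := Re_ip_le x y; nra.
Qed.

Lemma hnormB x y : N (x - y) <= N x + N y.
Proof. by rewrite -(hnormN y); exact: hnormD. Qed.

Lemma hnorm_triangle z x y : N (x - y) <= N (x - z) + N (z - y).
Proof. by rewrite -[x - y](subrKA z); exact: hnormD. Qed.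

Lemma cabs_ip_le x y : cabs (ip x y) <= N x * N y.
Proof.
have [i0|in0] := eqVneq (cabs (ip x y)) 0; first by rewrite i0 mulr_ge0.
have ip_gt0 : 0 < cabs (ip x y) by rewrite lt_neqAle eq_sym in0 cabs_ge0.
(* Multiplying [x] by the conjugate of [ip x y] makes the inner product real, equal to its squared
   modulus. *)
have := Re_ip_le (conjc (ip x y) *: x) y.
rewrite ipZl mulrC mulc_conj hnormZ cabs_conj /= expr2 -mulrA.
by rewrite ler_pM2l.
Qed.

Lemma hnorm_sum (I : Type) (s : seq I) (P : pred I) (F : I -> H) :
  N (\sum_(i <- s | P i) F i) <= \sum_(i <- s | P i) N (F i).
Proof.
elim/big_rec2: _ => [|i y x _ le_xy]; first by rewrite hnorm0.
by apply: (le_trans (hnormD _ _)); rewrite lerD2l.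
Qed.

Definition hcvg (u : nat -> H) (l : H) :=
  forall e : R, 0 < e -> exists n0, forall n, (n0 <= n)%N -> N (u n - l) < e.

Lemma hcvg_cst l : hcvg (fun=> l) l.
Proof. by move=> e e0; exists 0%N => n _; rewrite subrr hnorm0. Qed.

Lemma hcvg_le u l c (w : H) n0 : hcvg u l ->
  (forall n, (n0 <= n)%N -> N (u n - w) <= c) -> N (l - w) <= c.
Proof.
move=> ul uc; apply/ler_addgt0Pr => e /ul[n1 un1].
have := un1 (maxn n0 n1) (leq_maxr _ _); have := uc (maxn n0 n1) (leq_maxl _ _).
have := hnorm_triangle (u (maxn n0 n1)) l w.
by rewrite (hnormBC l (u _)); lra.
Qed.

Lemma hcvg_norm_le u l c : hcvg u l -> (forall n, N (u n) <= c) -> N l <= c.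
Proof.
move=> ul uc; rewrite -[l]subr0; apply: (@hcvg_le u l c 0 0) => // n _.
by rewrite subr0.
Qed.

Lemma hcvg_unique u l l' : hcvg u l -> hcvg u l' -> l = l'.
Proof.
move=> ul ul'; apply/eqP; rewrite -subr_eq0; apply/eqP/hnorm_eq0/le_anti.
rewrite hnorm_ge0 andbT; apply/ler_addgt0Pr => e e0; rewrite add0r.
have [n0 un0] := ul' _ e0.
by apply: (hcvg_le (n0 := n0) ul) => n /un0 /ltW.
Qed.

Lemma hcvgD u v l m : hcvg u l -> hcvg v m -> hcvg (fun n => u n + v n) (l + m).
Proof.
move=> ul vm e e0; have e2 : 0 < e / 2 by lra.
have [n0 un0] := ul _ e2; have [n1 vn1] := vm _ e2.
exists (maxn n0 n1) => n; rewrite geq_max => /andP[/un0 h0 /vn1 h1].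
by have := hnormD (u n - l) (v n - m); rewrite addrACA -opprD; lra.
Qed.

Lemma hcvg_lipschitz (f : H -> H) M u l :
  (forall x y, N (f x - f y) <= M * N (x - y)) -> hcvg u l ->
  hcvg (fun n => f (u n)) (f l).
Proof.
move=> fM ul e e0; have M1 : 0 < `|M| + 1 by rewrite ltr_wpDl.
have [n0 un0] := ul (e / (`|M| + 1)) (divr_gt0 e0 M1).
exists n0 => n /un0; rewrite ltr_pdivlMr // => h.
apply: (le_lt_trans (fM _ _)); apply: le_lt_trans h.
by rewrite mulrC ler_wpM2l // (le_trans (ler_norm _)) // lerDl.
Qed.

Lemma hcvgZ a u l : hcvg u l -> hcvg (fun n => a *: u n) (a *: l).
Proof.
apply: (@hcvg_lipschitz (fun x => a *: x) (cabs a)) => x y.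
by rewrite -scalerBr hnormZ.
Qed.

Lemma eq_hcvg u v l : u =1 v -> hcvg u l -> hcvg v l.
Proof. by move=> uv ul e /ul[n0 h]; exists n0 => n /h; rewrite uv. Qed.

Lemma hcvg_shift k u l : hcvg u l -> hcvg (fun n => u (n + k)%N) l.
Proof.
move=> ul e /ul[n0 h]; exists n0 => n n0n; apply: h.
by rewrite (leq_trans n0n) ?leq_addr.
Qed.

(** Carries adjointness relations to limits: the error is [ip x (v n - m) - ip (u n - l) y], and
    Cauchy-Schwarz bounds both terms. *)
Lemma ip_eq_limit u v l m x y : hcvg u l -> hcvg v m ->
  (forall n, ip (u n) y = ip x (v n)) -> ip l y = ip x m.
Proof.
move=> ul vm uv; apply/eqP; rewrite -subr_eq0 -cabs_eq0; apply/eqP/le_anti.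
rewrite cabs_ge0 andbT; apply/ler_addgt0Pr => e e0; rewrite add0r.
have K0 : 0 < N x + N y + 1 by rewrite ltr_wpDl // addr_ge0.
have [n0 un0] := ul _ (divr_gt0 e0 K0); have [n1 vn1] := vm _ (divr_gt0 e0 K0).
pose n := maxn n0 n1.
have := un0 n (leq_maxl _ _); have := vn1 n (leq_maxr _ _).
have -> : ip l y - ip x m = ip x (v n - m) - ip (u n - l) y.
  by rewrite !ipE uv; ring.
set c := e / _ => h1 h2.
have -> : e = c * (N x + N y + 1) by rewrite /c divfK // gt_eqF.
have := le_normcD (ip x (v n - m)) (- ip (u n - l) y); rewrite normcN.
have := cabs_ip_le x (v n - m); have := cabs_ip_le (u n - l) y.
have c0 : 0 < c by apply: divr_gt0.
have := ler_wpM2l (hnorm_ge0 x) (ltW h1); have := ler_wpM2r (hnorm_ge0 y) (ltW h2).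
by rewrite !mulrDr mulr1 (mulrC (N x) c); lra.
Qed.

(** * Square roots and signs of self-adjoint contractions *)

Definition lin_of (f : H -> H) (linf : linear_op f) : {linear H -> H} :=
  HB.pack f (GRing.isLinear.Build _ _ _ _ f linf).

Definition symop (f : H -> H) := forall x y, ip (f x) y = ip x (f y).

Definition contraction (f : H -> H) := forall x, N (f x) <= N x.

Definition symmetry (f : H -> H) := symop f /\ forall x, f (f x) = x.

Lemma symmetry_isometry f x : symmetry f -> N (f x) = N x.
Proof. by case=> fs ff; rewrite /hnorm fs ff. Qed.

Hypothesis complete : complete_space ip.

(** A single small [c n] is enough for the Cauchy property, since all later terms are compared with
    [B n x]. *)
Lemma op_limit (B : nat -> {linear H -> H}) (c : nat -> R) :
  (forall m n x, (n <= m)%N -> N (B m x - B n x) <= c n * N x) ->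
  (forall e, 0 < e -> exists n, c n < e) ->
  exists L : {linear H -> H}, forall x, hcvg (fun n => B n x) (L x).
Proof.
move=> Bc c0.
have ex x : exists l, hcvg (fun n => B n x) l.
  apply: complete => e e0; have K0 : 0 < N x + 1 by rewrite ltr_wpDl.
  have [n0 cn0] := c0 (e / 2 / (N x + 1)) (divr_gt0 (divr_gt0 e0 (ltr0Sn _ _)) K0).
  have small n : (n0 <= n)%N -> N (B n x - B n0 x) < e / 2.
    move=> n0n; apply: (le_lt_trans (Bc _ _ _ n0n)).
    have e20 : 0 < e / 2 by lra.
    have [x0|xp] := eqVneq (N x) 0; first by rewrite x0 mulr0.
    have xp' : 0 < N x by rewrite lt_neqAle eq_sym xp hnorm_ge0.
    rewrite -ltr_pdivlMr //; apply: (lt_trans cn0).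
    by rewrite ltr_pM2l // ltf_pV2 ?posrE // ltrDl.
  exists n0 => m n /small hm /small hn.
  by have := hnorm_triangle (B n0 x) (B m x) (B n x); rewrite (hnormBC (B n0 x)); lra.
have [L BL] := choice ex.
have linL : linear_op L.
  move=> a x y; apply: (hcvg_unique (BL _)).
  apply: eq_hcvg (hcvgD (hcvgZ a (BL x)) (BL y)) => n /=.
  by rewrite linearP.
by exists (lin_of linL).
Qed.

Lemma half_norm x : N (2^-1 *: x) = 2^-1 * N x.
Proof.
have -> : 2^-1 = (2^-1 : R)%:C :> R[i] by rewrite fmorphV rmorph_nat.
by rewrite hnormZr ger0_norm // invr_ge0.
Qed.

Section SquareRoot.
Variable T : {linear H -> H}.
Hypotheses (symT : symop T) (contrT : contraction T).

(** Successive approximation for B = (T + B^2)/2, which is equivalent to (1 - B)^2 = 1 - T. Each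
    iterate is a polynomial in [T]. *)
Fixpoint sqrt_iter n : {linear H -> H} :=
  if n is k.+1 then 2^-1 \*: (T \+ (sqrt_iter k \o sqrt_iter k)) else \0.

Fixpoint scalar_iter n : R :=
  if n is k.+1 then 2^-1 * (1 + scalar_iter k ^+ 2) else 0.

Lemma sqrt_iterS n x : sqrt_iter n.+1 x = 2^-1 *: (T x + sqrt_iter n (sqrt_iter n x)).
Proof. by []. Qed.

Lemma scalar_iter_bounds n : 0 <= scalar_iter n <= 1.
Proof.
elim: n => [|n /andP[b0 b1]] /=; first by rewrite lexx ler01.
by apply/andP; split; nra.
Qed.

(** With d = 1 - b the recursion becomes d' = d - d^2/2, whose solution decays like 2/n. *)
Lemma scalar_iter_rate n : 1 - scalar_iter n <= 2 / n.+2%:R.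
Proof.
elim: n => [|n]; first by rewrite subr0 divff // pnatr_eq0.
have /andP[b0 b1] := scalar_iter_bounds n.
rewrite /= -[n.+3]addn3 -[n.+2]addn2 !natrD; have : 0 <= n%:R :> R by rewrite ler0n.
move: (n%:R) (scalar_iter n) b0 b1 => k b b0 b1 k0.
rewrite !ler_pdivlMr; [|nra..] => h.
have -> : 1 - 2^-1 * (1 + b ^+ 2) = (1 - b) - 2^-1 * (1 - b) ^+ 2 by field.
have d0 : 0 <= 1 - b by lra.
(* Expanding the product gives d (2 - d) (k + 3) <= 4 - d^2 <= 4, which is the induction step. *)
have : 0 <= (2 - (1 - b) * (k + 2)) * (2 - (1 - b)).
  by apply: mulr_ge0; lra.
move: (1 - b) d0 h => d d0 h; nra.
Qed.

Lemma sqrt_iter_norm n x : N (sqrt_iter n x) <= scalar_iter n * N x.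
Proof.
elim: n x => [|n IH] x; first by rewrite /= hnorm0 mul0r.
rewrite sqrt_iterS half_norm /= -mulrA ler_pM2l ?invr_gt0 //.
apply: (le_trans (hnormD _ _)); rewrite mulrDl mul1r lerD //.
apply: (le_trans (IH _)); rewrite expr2 -mulrA ler_wpM2l //.
by case/andP: (scalar_iter_bounds n).
Qed.

Lemma sqrt_iter_step n x : N (sqrt_iter n.+1 x - sqrt_iter n x)
  <= (scalar_iter n.+1 - scalar_iter n) * N x.
Proof.
elim: n x => [|n IH] x.
  by have := sqrt_iter_norm 1 x; rewrite /= !subr0.
rewrite 2!sqrt_iterS -scalerBr half_norm.
have -> : scalar_iter n.+2 - scalar_iter n.+1
  = 2^-1 * (scalar_iter n.+1 ^+ 2 - scalar_iter n ^+ 2) by rewrite /=; field.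
rewrite -mulrA ler_pM2l ?invr_gt0 //.
set p := sqrt_iter n.+1; set q := sqrt_iter n.
(* The splitting p^2 - q^2 = p (p - q) + (p - q) q mirrors b^2 - a^2 = b (b - a) + (b - a) a; the
   induction hypothesis is used at [x] and at [q x]. *)
have -> : T x + p (p x) - (T x + q (q x)) = p (p x - q x) + (p (q x) - q (q x)).
  by rewrite opprD addrACA subrr add0r linearB /= addrA subrK.
apply: (le_trans (hnormD _ _)).
have /andP[b0 b1] := scalar_iter_bounds n.+1.
have := sqrt_iter_norm n.+1 (p x - q x); have := IH x; have := IH (q x).
have := sqrt_iter_norm n x; rewrite -/p -/q.
have mono : 0 <= scalar_iter n.+1 - scalar_iter n.
  by rewrite /= ; have := scalar_iter_bounds n; nra.
move: (scalar_iter n.+1) (scalar_iter n) b0 b1 mono => b a b0 b1 mono h1 h2 h3 h4.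
have h5 := ler_wpM2l b0 h3; have h6 := ler_wpM2l mono h1.
nra.
Qed.

Lemma sqrt_iter_sym n : symop (sqrt_iter n).
Proof.
elim: n => [|n IH] x y; first by rewrite /= !ipE.
by rewrite 2!sqrt_iterS !ipE symT !IH conjc_inv conjc_nat.
Qed.

Lemma sqrt_iter_commutes (K : {linear H -> H}) n x :
  (forall y, K (T y) = T (K y)) -> K (sqrt_iter n x) = sqrt_iter n (K x).
Proof.
move=> KT; elim: n x => [|n IH] x; first by rewrite /= linear0.
by rewrite 2!sqrt_iterS linearZ linearD /= KT !IH.
Qed.

(* [1 - B] is a positive square root of [1 - T]; at the scalar [1] the iteration
   majorises the operator iteration, which gives convergence in norm. *)
Lemma sqrt_op : exists B : {linear H -> H},
  [/\ symop B, contraction B, forall x, B (B x) = 2 *: B x - T x &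
      forall K : {linear H -> H}, symop K -> (forall x, K (T x) = T (K x)) ->
        forall x, K (B x) = B (K x)].
Proof.
have [] := @op_limit sqrt_iter (fun n => 1 - scalar_iter n).
- move=> m n x nm; apply: (@le_trans _ _ ((scalar_iter m - scalar_iter n) * N x)).
    rewrite -(subnKC nm); elim: (m - n)%N => [|k IH].
      by rewrite addn0 !subrr mul0r hnorm0.
    rewrite addnS; have := sqrt_iter_step (n + k) x.
    have := hnorm_triangle (sqrt_iter (n + k) x) (sqrt_iter (n + k).+1 x) (sqrt_iter n x).
    move: (scalar_iter _.+1) (scalar_iter (n + k)) (scalar_iter n) IH => a b c; lra.
  by rewrite ler_wpM2r // lerD2r; case/andP: (scalar_iter_bounds m).
- move=> e e0; exists (Num.truncn (2 / e)).
  apply: (le_lt_trans (scalar_iter_rate _)).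
  rewrite ltr_pdivrMr ?ltr0n // mulrC -ltr_pdivrMr //.
  apply: (lt_trans (truncnS_gt _)) => //; by rewrite ltr_nat.
move=> B cvB.
have symB : symop B.
  by move=> x y; apply: (ip_eq_limit (cvB x) (cvB y)) => n; exact: sqrt_iter_sym.
exists B; split=> //.
- move=> x; apply: (hcvg_norm_le (cvB x)) => n; apply: (le_trans (sqrt_iter_norm _ _)).
  by rewrite ler_piMl //; case/andP: (scalar_iter_bounds n).
- move=> x.
  have contrn n y : N (sqrt_iter n y) <= N y.
    apply: (le_trans (sqrt_iter_norm _ _)).
    by rewrite ler_piMl //; case/andP: (scalar_iter_bounds n).
  (* Operator and argument vary together; as the iterates are contractions, the inner argument may
     be replaced by [B x]. *)
  have cvBB : hcvg (fun n => sqrt_iter n (sqrt_iter n x)) (B (B x)).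
    move=> e e0; have e2 : 0 < e / 2 by lra.
    have [n0 h0] := cvB x _ e2; have [n1 h1] := cvB (B x) _ e2.
    exists (maxn n0 n1) => n; rewrite geq_max => /andP[/h0 g0 /h1 g1].
    have := hnorm_triangle (sqrt_iter n (B x)) (sqrt_iter n (sqrt_iter n x)) (B (B x)).
    rewrite -linearB; have := contrn n (sqrt_iter n x - B x); lra.
  have Bx : B x = 2^-1 *: (T x + B (B x)).
    apply: (hcvg_unique (hcvg_shift 1 (cvB x))).
    apply: eq_hcvg (hcvgZ _ (hcvgD (hcvg_cst (T x)) cvBB)) => n.
    by rewrite addn1.
  by rewrite [in RHS]Bx scalerA divff ?pnatr_eq0 // scale1r addrC addKr.
(* Self-adjointness of [K] takes the place of continuity: [K] is moved across the inner product
   before passing to the limit. *)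
- move=> K symK KT x; apply: ip_ext => y; rewrite symK [RHS]symB.
  apply: (ip_eq_limit (cvB x) (cvB y)) => n.
  by rewrite -symK sqrt_iter_commutes // sqrt_iter_sym.
Qed.

End SquareRoot.

(** * Nearest points and orthogonal projections *)

Lemma inv_nat_small (e : R) : 0 < e -> exists n, n.+1%:R^-1 < e.
Proof.
move=> e0; exists (Num.truncn e^-1).
by rewrite invf_plt ?posrE ?ltr0n // truncnS_gt.
Qed.

Definition closed_subspace (M : H -> Prop) :=
  [/\ M 0, forall a x y, M x -> M y -> M (a *: x + y) &
      forall u l, hcvg u l -> (forall n, M (u n)) -> M l].

(** Subtracting from [z] its component [t * ip z m] along [m], with [t = 1 / N m ^+ 2], lowers the
    squared norm by [t * |ip z m|^2]; minimality forces this to vanish. *)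
Lemma orthogonal_of_nearest (M : H -> Prop) (z : H) :
  (forall a m, M m -> M (a *: m)) -> (forall m, M m -> N z ^+ 2 <= N (z - m) ^+ 2) ->
  forall m, M m -> ip z m = 0.
Proof.
move=> MZ zmin m Mm; have [m0|mn0] := eqVneq (N m) 0.
  by rewrite (hnorm_eq0 m0) ip0r.
apply/eqP; rewrite -cabs_eq0 -sqrf_eq0 eq_le sqr_ge0 andbT.
pose t := (N m ^+ 2)^-1.
have := zmin _ (MZ (t%:C * ip z m) _ Mm).
have mp : 0 < N m ^+ 2 by rewrite exprn_gt0 // lt_neqAle eq_sym mn0 hnorm_ge0.
have tp : 0 < t by rewrite invr_gt0.
have e : conjc (t%:C * ip z m) * ip z m = t%:C * (cabs (ip z m) ^+ 2)%:C.
  by rewrite conjcM conjc_real -mulrA (mulrC (conjc _)) mulc_conj.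
rewrite hnormB_sqr hnormZ cabsM cabs_real ipZr e Re_realM /= ger0_norm ?(ltW tp) //.
have -> : (t * cabs (ip z m) * N m) ^+ 2 = t * cabs (ip z m) ^+ 2.
  by rewrite !exprMn mulrAC [t ^+ 2]expr2 -(mulrA t) mulVf ?gt_eqF // mulr1.
move: (cabs _ ^+ 2) => w h; have : t * w <= 0 by lra.
by rewrite pmulr_rle0.
Qed.

Lemma projection_ex (M : H -> Prop) x : closed_subspace M ->
  exists p, M p /\ forall m, M m -> ip (x - p) m = 0.
Proof.
move=> [M0 MP Mcl].
have MZ a m : M m -> M (a *: m) by move=> Mm; rewrite -[a *: m]addr0; exact: MP.
have MD m m' : M m -> M m' -> M (m + m') by move=> Mm; rewrite -[m]scale1r; exact: MP.
pose E : set R := [set N (x - m) ^+ 2 | m in M]%classic.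
have hE : has_inf E.
  split; first by exists (N (x - 0) ^+ 2), 0.
  by exists 0 => _ [m _ <-]; exact: sqr_ge0.
set D := inf E.
have DE m : M m -> D <= N (x - m) ^+ 2.
  by move=> Mm; apply: ge_inf; [case: hE|exists m].
have ex n : exists m, M m /\ N (x - m) ^+ 2 < D + n.+1%:R^-1.
  have n0 : 0 < n.+1%:R^-1 :> R by rewrite invr_gt0 ltr0n.
  by have [_ [m Mm <-] h] := inf_adherent n0 hE; exists m.
have [u Mu] := choice ex.
(* Parallelogram identity: the midpoint of [u m] and [u n] lies in [M], so its squared distance to
   [x] is at least [D]. Hence a minimising sequence is Cauchy. *)
have dist m n : N (u m - u n) ^+ 2 <= 2 * m.+1%:R^-1 + 2 * n.+1%:R^-1.
  have [Mm hm] := Mu m; have [Mn hn] := Mu n.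
  have := DE _ (MZ 2^-1 _ (MD _ _ Mm Mn)).
  have e1 : u m - u n = (x - u n) - (x - u m) by vring.
  have e2 : 2^-1 *: ((x - u n) + (x - u m)) = x - 2^-1 *: (u m + u n).
    apply: ip_ext => z; rewrite !ipE; by field; rewrite ?pnatr_eq0.
  rewrite -e2 half_norm exprMn e1 hnormB_sqr (hnormD_sqr (x - u n)).
  move: (N (x - u m)) (N (x - u n)) (Re _) (m.+1%:R^-1) (n.+1%:R^-1) hm hn {e1 e2}.
  by move=> p q r a b h1 h2 h3; nra.
have cauchy : exists l, hcvg u l.
  apply: complete => e e0; have [n0 hn0] := inv_nat_small (divr_gt0 (exprn_gt0 2 e0) (ltr0Sn R 3)).
  exists n0 => m n hm hn; rewrite -(ltr_pXn2r (n := 2)) ?nnegrE ?(ltW e0) //.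
  apply: (le_lt_trans (dist m n)).
  have inv_le k : (n0 <= k)%N -> k.+1%:R^-1 <= n0.+1%:R^-1 :> R.
    by move=> h; rewrite lef_pV2 ?posrE ?ltr0n // ler_nat ltnS.
  move: (inv_le _ hm) (inv_le _ hn) hn0.
  by move: (m.+1%:R^-1) (n.+1%:R^-1) (n0.+1%:R^-1) => a b c; lra.
have [p up] := cauchy; exists p; split; first by apply: (Mcl _ _ up) => n; case: (Mu n).
have xp : N (x - p) ^+ 2 <= D.
  apply/ler_addgt0Pr => e e0; have [n0 hn0] := inv_nat_small e0.
  have D0 : 0 <= D + e.
    rewrite addr_ge0 ?(ltW e0) //; apply: lb_le_inf; first by case: hE.
    by move=> _ [m _ <-]; exact: sqr_ge0.
  rewrite -(sqr_sqrtr D0) ler_pXn2r ?nnegrE ?sqrtr_ge0 // hnormBC.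
  apply: (hcvg_le (n0 := n0) up) => n n0n.
  rewrite -(ler_pXn2r (n := 2)) ?nnegrE ?sqrtr_ge0 // (sqr_sqrtr D0) hnormBC.
  have [_ /ltW h] := Mu n; apply: (le_trans h); rewrite lerD2l.
  apply: (le_trans _ (ltW hn0)).
  by rewrite lef_pV2 ?posrE ?ltr0n // ler_nat ltnS.
have Mp : M p by apply: (Mcl _ _ up) => n; case: (Mu n).
apply: orthogonal_of_nearest => // m Mm.
apply: (le_trans xp); rewrite -addrA -opprD; apply: DE; exact: MD.
Qed.

(** Linearity comes from the characterisation of [P x] in the third clause, which is also how
    idempotence and commutation are derived later. *)
Lemma projection_op (M : H -> Prop) : closed_subspace M ->
  exists P : {linear H -> H},
    [/\ forall x, M (P x), forall x m, M m -> ip (x - P x) m = 0,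
        forall x p, M p -> (forall m, M m -> ip (x - p) m = 0) -> P x = p &
        symop P].
Proof.
move=> clM; have [M0 MP _] := clM.
have MB m m' : M m -> M m' -> M (m - m').
  by move=> Mm Mm'; rewrite addrC -scaleN1r; exact: MP.
have [P PM] := choice (fun x => projection_ex x clM).
have MPx x : M (P x) by case: (PM x).
have orthP x m : M m -> ip (x - P x) m = 0 by case: (PM x) => _; apply.
have uniqP x p : M p -> (forall m, M m -> ip (x - p) m = 0) -> P x = p.
  move=> Mp xp; apply/eqP; rewrite -subr_eq0; apply/eqP/hnorm_eq0/eqP.
  have e : P x - p = (x - p) - (x - P x) by vring.
  have Md : M ((x - p) - (x - P x)) by rewrite -e; exact: MB.
  by rewrite e -sqrf_eq0 hnorm_sqr ipDl ipNl xp // orthP // subr0.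
have linP : linear_op P.
  move=> a x y; apply: uniqP => [|m Mm]; first exact: MP.
  have -> : a *: x + y - (a *: P x + P y) = a *: (x - P x) + (y - P y).
    by rewrite scalerBr opprD addrACA.
  by rewrite !ipE -!ipNl -!ipDl orthP // orthP // mulr0 addr0.
exists (lin_of linP); split=> // x y /=.
have : ip (P x) (y - P y) = 0 by rewrite ipC orthP // conjc0.
have := orthP x _ (MPx y); rewrite !ipE => /eqP; rewrite subr_eq0 => /eqP ->.
by move/eqP; rewrite subr_eq0 => /eqP ->.
Qed.

(* [S] is the sign of [A]: it equals [1] on the kernel of [|A| - A] and [-1] on
   the orthogonal complement, so that [A = S |A|]. *)
Lemma sign_op (A : {linear H -> H}) : symop A -> contraction A ->
  exists S : {linear H -> H},
    [/\ symmetry S, forall x, N (2 *: A x - S x) <= N x &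
        forall K : {linear H -> H}, symop K -> (forall x, K (A x) = A (K x)) ->
          forall x, K (S x) = S (K x)].
Proof.
(* For T = 1 - A^2 the operator [Q] = 1 - B below satisfies Q^2 = A^2 and is positive, so it is the
   absolute value of [A]. *)
move=> symA contrA; pose T : {linear H -> H} := idfun \- (A \o A).
have symT : symop T by move=> x y; rewrite /= !ipE !symA.
have contrT : contraction T.
  move=> x; rewrite -(ler_pXn2r (n := 2)) ?nnegrE //= hnormB_sqr ipC Re_conj symA -hnorm_sqr.
  have := contrA (A x); have := hnorm_ge0 (A (A x)); have := hnorm_ge0 (A x); nra.
have [B [symB contrB BB commB]] := sqrt_op symT contrT.
have [Q QE] : exists Q : {linear H -> H}, forall x, Q x = x - B x.
  by exists (idfun \- B).
have symQ : symop Q by move=> x y; rewrite !QE !ipE symB.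
have QQ x : Q (Q x) = A (A x).
  rewrite !QE linearB BB /=; vring.
have NQ x : N (Q x) = N (A x) by rewrite /hnorm symQ QQ symA.
have Qge0 x : 0 <= Re (ip (Q x) x).
  rewrite QE !ipE ReD ReN -hnorm_sqr subr_ge0; apply: (le_trans (Re_ip_le _ _)).
  by rewrite expr2 ler_wpM2r.
(* This is Q^2 <= Q: expand positivity of [Q] at [x - Q x] and bound [N (Q (Q x))] by [N (Q x)]. *)
have Qsq x : N (Q x) ^+ 2 <= Re (ip (Q x) x).
  have := Qge0 (x - Q x); rewrite linearB !ipE (symQ (Q x) x) !(ReD, ReN) -hnorm_sqr.
  have := Re_ip_le (Q (Q x)) (Q x); have := contrA (Q x); rewrite -NQ.
  have := hnorm_ge0 (Q x); nra.
have commQ (K : {linear H -> H}) : symop K -> (forall x, K (A x) = A (K x)) ->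
    forall x, K (Q x) = Q (K x).
  move=> symK KA x; rewrite !QE linearB commB // => y.
  by rewrite /= linearB /= !KA.
have QA x : A (Q x) = Q (A x) by apply: commQ.
pose M v := Q v = A v.
have clM : closed_subspace M.
  split; rewrite /M; first by rewrite !linear0.
    by move=> a x y Mx My; rewrite !linearP Mx My.
  move=> u l ul Mu; apply: ip_ext => z; rewrite symQ symA.
  have h n : ip (u n) (Q z - A z) = ip 0 0.
    by rewrite ipDr ipNr -symQ -symA Mu subrr ip0l.
  have /eqP := ip_eq_limit ul (hcvg_cst 0) h.
  by rewrite ip0l ipDr ipNr subr_eq0 => /eqP.
have [P [MPx orthP uniqP symP]] := projection_op clM.
have PP x : P (P x) = P x by apply: uniqP => // m _; rewrite subrr ip0l.
have [S SE] : exists S : {linear H -> H}, forall x, S x = 2 *: P x - x.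
  by exists ((2 \*: P) \- idfun).
have symS : symop S by move=> x y; rewrite !SE !ipE symP conjc_nat.
have SS x : S (S x) = x.
  rewrite !SE linearB linearZ /= PP; vring.
have commS (K : {linear H -> H}) : symop K -> (forall x, K (A x) = A (K x)) ->
    forall x, K (S x) = S (K x).
  move=> symK KA x; rewrite !SE linearB linearZ /=; congr (_ *: _ - _).
  symmetry; apply: uniqP => [|m Mm]; first by rewrite /M -commQ // MPx KA.
  by rewrite -linearB symK orthP // /M -commQ // Mm KA.
have QS x : Q (S x) = A x.
  (* Since (Q - A)(Q + A) = 0, the range of Q + A lies in [M]; being self-adjoint, Q + A then kills
     the orthogonal complement of [M]. *)
  have Mneg : Q (x - P x) + A (x - P x) = 0.
    have MQA v : M (Q v + A v) by rewrite /M !linearD /= QQ QA addrC.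
    apply/hnorm_eq0/eqP; rewrite -sqrf_eq0 hnorm_sqr [ip _ _]ipDl symQ symA -ipDr.
    by rewrite orthP.
  have := MPx x; rewrite /M => PM; move/eqP: Mneg; rewrite addr_eq0 => /eqP Mneg.
  have -> : S x = P x - (x - P x) by rewrite SE; vring.
  by rewrite linearB PM Mneg opprK -linearD addrC subrK.
exists S; split=> // x.
have SQ y : S (Q y) = A y by rewrite -commS // QS.
(* Because A = S Q, the remainder is S (2 Q - 1); [S] is isometric, and 2 Q - 1 is a contraction by
   Q^2 <= Q. *)
have -> : 2 *: A x - S x = S (2 *: Q x - x) by rewrite linearB linearZ /= SQ.
rewrite (@symmetry_isometry S) // -(ler_pXn2r (n := 2)) ?nnegrE // hnormB_sqr.
have -> : 2 = (2 : R)%:C :> R[i] by rewrite rmorph_nat.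
rewrite ipZl hnormZr Re_realM ger0_norm //; have := Qsq x; nra.
Qed.

(** * Approximation by operators with finite spectrum *)

(** One step writes A = (S0 + A1)/2 with A1 = 2 A - S0 again a self-adjoint contraction, so each
    digit halves the error. The last clause makes the digits commute with one another and later with
    those of a second operator. *)
Lemma dyadic_symmetries n (A : {linear H -> H}) : symop A -> contraction A ->
  exists S : nat -> {linear H -> H},
    [/\ forall i, symmetry (S i), forall i j x, S i (S j x) = S j (S i x),
        forall x, N (A x - \sum_(i < n) (2^-1 ^+ i.+1)%:C *: S i x) <= 2^-1 ^+ n * N x &
        forall K : {linear H -> H}, symop K -> (forall x, K (A x) = A (K x)) ->
          forall i x, K (S i x) = S i (K x)].
Proof.
elim: n A => [|n IH] A symA contrA.
  exists (fun=> idfun); split=> // x.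
  by rewrite big_ord0 subr0 expr0 mul1r.
have [S0 [symS0 near0 comm0]] := sign_op symA contrA.
have [A1 A1E] : exists A1 : {linear H -> H}, forall x, A1 x = 2 *: A x - S0 x.
  by exists ((2 \*: A) \- S0).
have symA1 : symop A1.
  by move=> x y; rewrite !A1E !ipE conjc_nat symA; case: symS0 => -> _.
have contrA1 : contraction A1 by move=> x; rewrite A1E.
have [S [symS SS near comm]] := IH A1 symA1 contrA1.
have comm1 (K : {linear H -> H}) : symop K -> (forall x, K (A x) = A (K x)) ->
    forall x, K (A1 x) = A1 (K x).
  by move=> symK KA x; rewrite !A1E linearB linearZ /= KA comm0.
have S0S i x : S0 (S i x) = S i (S0 x).
  apply: comm; first by case: symS0.
  by apply: comm1; [case: symS0|move=> y; rewrite comm0].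
exists (fun i => if i is j.+1 then S j else S0); split.
- by case.
- by move=> [|i] [|j] x //; rewrite SS.
- move=> x; rewrite big_ord_recl /=.
  have -> : A x - ((2^-1 ^+ 1)%:C *: S0 x + \sum_(i < n) (2^-1 ^+ (bump 0 i).+1)%:C *: S i x)
    = (2^-1 : R)%:C *: (A1 x - \sum_(i < n) (2^-1 ^+ i.+1)%:C *: S i x).
    rewrite opprD addrA scalerBr; congr (_ - _).
      rewrite A1E expr1 scalerBr scalerA; congr (_ - _).
      by rewrite -(rmorph_nat (real_complex R)) -rmorphM /= mulVf ?pnatr_eq0 // scale1r.
    rewrite scaler_sumr; apply: eq_bigr => i _.
    by rewrite scalerA -rmorphM /= -exprS.
  by rewrite hnormZr ger0_norm ?invr_ge0 // exprS -mulrA ler_pM2l ?invr_gt0.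
- move=> K symK KA [|i] x; first exact: comm0.
  by apply: comm => //; exact: comm1.
Qed.

(** Each new symmetry splits v into (v + G v)/2 and (v - G v)/2, and commutation preserves the signs
    already obtained. *)
Lemma joint_eigenvectors (G : nat -> {linear H -> H}) m :
  (forall i, symmetry (G i)) -> (forall i j x, G i (G j x) = G j (G i x)) ->
  forall d, exists2 l : seq H, d = \sum_(v <- l) v &
    forall v, v \in l -> forall i, (i < m)%N -> G i v = v \/ G i v = - v.
Proof.
move=> symG GG; elim: m => [|m IH] d.
  by exists [:: d] => //; rewrite big_seq1.
have [l -> {d} lP] := IH d.
exists (map (fun v => 2^-1 *: (v + G m v)) l ++ map (fun v => 2^-1 *: (v - G m v)) l).
  rewrite big_cat /= !big_map -big_split /=; apply: eq_bigr => v _.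
  by apply: ip_ext => z; rewrite !ipE; field.
have Gm v : G m (G m v) = v by case: (symG m).
move=> w; rewrite mem_cat => /orP[] /mapP[v vl ->] i; rewrite ltnS leq_eqVlt.
  case/orP=> [/eqP ->|/(lP _ vl) iv]; rewrite linearZ linearD /=.
    by left; rewrite Gm addrC.
  by case: iv => Gv; rewrite GG Gv ?linearN; [left|right] => //; rewrite -opprD scalerN.
case/orP=> [/eqP ->|/(lP _ vl) iv]; rewrite linearZ linearB /=.
  by right; rewrite Gm -scalerN opprB.
by case: iv => Gv; rewrite GG Gv ?linearN; [left|right] => //; rewrite -opprD scalerN.
Qed.

(** [f'] stands for the adjoint of [f]; recording its conjugate eigenvalue as well yields
    orthogonality of eigenvectors directly from the adjoint relation. *)
Definition eigen (f f' : H -> H) (c : R[i]) (v : H) := f v = c *: v /\ f' v = conjc c *: v.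

Lemma eigen_orthogonal (f f' : H -> H) b c v w :
  (forall x y, ip (f x) y = ip x (f' y)) ->
  eigen f f' b v -> eigen f f' c w -> b != c -> ip v w = 0.
Proof.
move=> adj [fv _] [_ fw] bc; have := adj v w.
rewrite fv fw ipZl ipZr conjcK => /eqP; rewrite -subr_eq0 -mulrBl mulf_eq0 subr_eq0.
by rewrite (negPf bc) => /eqP.
Qed.

Lemma unitary_diagonal_approx (U : H -> H) (e : R) : unitary ip U -> 0 < e ->
  exists C C' : {linear H -> H},
    [/\ forall x y, ip (C x) y = ip x (C' y),
        forall x, N (U x - C x) <= e * N x &
        forall d, exists2 l : seq H, d = \sum_(v <- l) v &
          forall v, v \in l -> exists c, eigen C C' c v].
Proof.
move=> [linU _ [V [adj VU UV]]] e0; pose u := lin_of linU.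
have adj' x y : ip (V x) y = ip x (U y) by rewrite ipC -adj -ipC.
have linV : linear_op V.
  move=> a x y; apply: ip_ext => z.
  by rewrite adj' !ipE !adj'.
pose v := lin_of linV.
have NU x : N (U x) = N x by rewrite /hnorm adj VU.
have NV x : N (V x) = N x by rewrite /hnorm adj' UV.
(* [A] and [B] are the real part (U + V)/2 and the imaginary part (U - V)/(2i) of [U], where [V] is
   its adjoint. *)
have [A AE] : exists A : {linear H -> H}, forall x, A x = 2^-1 *: (U x + V x).
  by exists (2^-1 \*: (u \+ v)).
have [B BE] : exists B : {linear H -> H}, forall x, B x = ('i * 2^-1) *: (V x - U x).
  by exists (('i * 2^-1) \*: (v \- u)).
have conj_half : conjc 2^-1 = 2^-1 :> R[i] by rewrite conjc_inv conjc_nat.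
have conj_i : conjc 'i = - 'i :> R[i].
  by rewrite -complexiE; apply/eqP; rewrite eq_complex /= oppr0 !eqxx.
have symA : symop A by move=> x y; rewrite !AE !ipE adj adj' conj_half addrC.
have symB : symop B.
  by move=> x y; rewrite !BE !ipE adj adj' conjcM conj_i conj_half; ring.
have contrA : contraction A.
  move=> x; rewrite AE half_norm mulrC ler_pdivrMr //.
  by have := hnormD (U x) (V x); rewrite NU NV; lra.
have contrB : contraction B.
  move=> x; rewrite BE -scalerA hnormZ -complexiE /= expr0n expr1n add0r sqrtr1 mul1r.
  rewrite half_norm mulrC ler_pdivrMr //.
  by have := hnormB (V x) (U x); rewrite NU NV; lra.
have AB x : A (B x) = B (A x).
  by apply: ip_ext => z; rewrite !(AE, BE) !(ipE, adj, adj', UV, VU); ring.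
have UAB x : U x = A x + 'i *: B x.
  rewrite AE BE scalerA mulrA -expr2 sqrCi.
  apply: ip_ext => z; rewrite !ipE; by field; rewrite ?pnatr_eq0.
have [n hn] : exists n, 2^-1 ^+ n < e / 2 :> R.
  have [n hn] := inv_nat_small (divr_gt0 e0 (ltr0Sn R 1)); exists n.
  apply: le_lt_trans hn; rewrite exprVn lef_pV2 ?posrE ?exprn_gt0 ?ltr0n //.
  by rewrite -natrX ler_nat ltn_expl.
have [S [symS SS nearS commS]] := dyadic_symmetries n symA contrA.
have [S' [symS' SS' nearS' commS']] := dyadic_symmetries n symB contrB.
(* Commutation is transferred twice: [B] commutes with [A], hence with the digits of [A], and these
   in turn with the digits of [B]. *)
have S'S i j x : S' i (S j x) = S j (S' i x).
  symmetry; apply: commS'; first by case: (symS j).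
  by move=> y; symmetry; apply: commS => // z; rewrite AB.
pose w i : R[i] := (2^-1 ^+ i.+1)%:C.
(* The value ['i] of [b] gives [C], and [- 'i] gives its adjoint, as the digits are self-adjoint and
   the weights real. *)
pose comb b x := \sum_(i < n) w i *: S i x + b *: (\sum_(i < n) w i *: S' i x).
have linF b : linear_op (comb b).
  move=> a x y; rewrite /comb scalerDr addrACA scalerA mulrC -scalerA -scalerDr.
  congr (_ + _ *: _); rewrite scaler_sumr -big_split; apply: eq_bigr => i _ /=;
  by rewrite linearP scalerDr !scalerA mulrC.
pose C := lin_of (linF 'i); pose C' := lin_of (linF (- 'i)).
have CE x : C x = comb 'i x by [].
have CE' x : C' x = comb (- 'i) x by [].
have sum_sym (F : nat -> {linear H -> H}) x y : (forall i, symmetry (F i)) ->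
    ip (\sum_(i < n) w i *: F i x) y = ip x (\sum_(i < n) w i *: F i y).
  move=> symF; rewrite ip_suml ip_sumr; apply: eq_bigr => i _.
  by rewrite ipZl ipZr conjc_real; case: (symF i) => ->.
exists C, C'; split.
- move=> x y; rewrite CE CE' /comb !ipE -conj_i conjcK !sum_sym //.
- move=> x; rewrite UAB CE /comb opprD addrACA -scalerBr.
  apply: (le_trans (hnormD _ _)); rewrite hnormZ -complexiE /= expr0n expr1n add0r sqrtr1 mul1r.
  apply: (le_trans (lerD (nearS x) (nearS' x))); rewrite -mulrDl ler_wpM2r //.
  by lra.
(* The two families of digits are interleaved, even indices for [S] and odd ones for [S'], so that
   the first [n.*2] members are diagonalised jointly. *)
- move=> d; pose G i := if odd i then S' i./2 else S i./2.
  have [||l dl lP] := @joint_eigenvectors G n.*2 _ _ d.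
  + by move=> i; rewrite /G; case: ifP.
  + by move=> i j x; rewrite /G; case: ifP; case: ifP.
  exists l => // v0 vl; have {}lP := lP v0 vl.
  have ev (F : nat -> {linear H -> H}) : (forall i, (i < n)%N -> F i v0 = v0 \/ F i v0 = - v0) ->
      exists r : R, \sum_(i < n) w i *: F i v0 = r%:C *: v0.
    move=> Fv; have : forall i : 'I_n, exists r : R, F i v0 = r%:C *: v0.
      move=> i; have [->|->] := Fv i (ltn_ord i); first by exists 1; rewrite scale1r.
      by exists (-1); rewrite rmorphN1 scaleN1r.
    case/choice => r rP; exists (\sum_(i < n) 2^-1 ^+ i.+1 * r i).
    rewrite rmorph_sum scaler_suml; apply: eq_bigr => i _.
    by rewrite rP scalerA rmorphM.
  have [|r Sr] := ev S.
    by move=> i lt_in; have := lP i.*2; rewrite /G odd_double doubleK ltn_double; apply.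
  have [|r' Sr'] := ev S'.
    move=> i lt_in; have := lP i.*2.+1; rewrite /G /= odd_double /= uphalf_double; apply.
    by rewrite ltn_Sdouble.
  exists (r%:C + 'i * r'%:C); split.
    by rewrite CE /comb Sr Sr' scalerA -scalerDl.
  rewrite CE' /comb Sr Sr' scalerA -scalerDl; congr (_ *: _).
  by rewrite conjcD conjcM conj_i !conjc_real.
Qed.

(** * Closed spans and orthonormal systems *)

(** Coefficients live on all of [nat], so that sums of different lengths can be padded to a common
    one. *)
Definition span (w : nat -> H) (y : H) :=
  exists (n : nat) (c : nat -> R[i]), y = \sum_(i < n) c i *: w i.

(** Coefficients live on ['I_n] here, so that for [w i = iter i T x] this is literally the condition
    in [cyclic_op]. *)
Definition closed_span (w : nat -> H) (y : H) :=
  forall e : R, 0 < e -> exists (n : nat) (c : 'I_n -> R[i]),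
    N (y - \sum_(i < n) c i *: w i) < e.

Lemma sum_pad (w : nat -> H) (c : nat -> R[i]) n m : (n <= m)%N ->
  \sum_(i < n) c i *: w i = \sum_(i < m) (if (i < n)%N then c i else 0) *: w i.
Proof.
move=> nm; rewrite (big_ord_widen m (fun i => c i *: w i) nm) big_mkcond /=.
by apply: eq_bigr => i _; case: ifP; rewrite ?scale0r.
Qed.

Lemma span_gen (w : nat -> H) i : span w (w i).
Proof.
exists i.+1, (fun j => (j == i)%:R).
rewrite big_ord_recr /= eqxx scale1r big1 ?add0r // => j _.
by rewrite ltn_eqF // scale0r.
Qed.

Lemma span_lin (w : nat -> H) a x y : span w x -> span w y -> span w (a *: x + y).
Proof.
move=> [n [c ->]] [m [d ->]].
rewrite (sum_pad w c (leq_maxl n m)) (sum_pad w d (leq_maxr n m)).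
exists (maxn n m), (fun i => a * (if (i < n)%N then c i else 0) + (if (i < m)%N then d i else 0)).
rewrite scaler_sumr -big_split; apply: eq_bigr => i _ /=.
by rewrite scalerA scalerDl.
Qed.

Lemma span0 (w : nat -> H) : span w 0.
Proof. by exists 0%N, (fun=> 0); rewrite big_ord0. Qed.

Lemma span_sum (w : nat -> H) (I : Type) (s : seq I) (F : I -> H) (b : I -> R[i]) :
  (forall i, span w (F i)) -> span w (\sum_(i <- s) b i *: F i).
Proof.
move=> sF; elim: s => [|i s IH]; first by rewrite big_nil; exact: span0.
by rewrite big_cons; exact: span_lin.
Qed.

Lemma closed_spanP (w : nat -> H) (y : H) :
  closed_span w y <-> forall e, 0 < e -> exists2 s, span w s & N (y - s) < e.
Proof.
split=> h e /h => [[n [c hc]]|[_ [n [c ->]] hc]]; last by exists n, (fun i => c i).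
exists (\sum_(i < n) c i *: w i) => //.
exists n, (fun i => if insub i is Some j then c j else 0).
by apply: eq_bigr => i _; rewrite valK.
Qed.

Lemma closed_span_lin (w : nat -> H) a x y :
  closed_span w x -> closed_span w y -> closed_span w (a *: x + y).
Proof.
move=> /closed_spanP sx /closed_spanP sy; apply/closed_spanP => e e0.
have e2 : 0 < e / 2 by lra.
have K0 : 0 < cabs a + 1 by rewrite ltr_wpDl ?cabs_ge0.
have [u su hu] := sx _ (divr_gt0 e2 K0); have [v sv hv] := sy _ e2.
exists (a *: u + v); first exact: span_lin.
rewrite opprD addrACA -scalerBr; apply: (le_lt_trans (hnormD _ _)); rewrite hnormZ.
move: hu; rewrite ltr_pdivlMr // => hu; have := hnorm_ge0 (x - u); have := cabs_ge0 a; nra.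
Qed.

Lemma span_closed_span (w : nat -> H) y : span w y -> closed_span w y.
Proof. by move=> sy; apply/closed_spanP => e e0; exists y => //; rewrite subrr hnorm0. Qed.

Lemma closed_span_closed (w : nat -> H) y :
  (forall e, 0 < e -> exists2 s, closed_span w s & N (y - s) < e) -> closed_span w y.
Proof.
move=> h; apply/closed_spanP => e e0; have e2 : 0 < e / 2 by lra.
have [s /closed_spanP/(_ _ e2)[t st ht] hs] := h _ e2.
by exists t => //; have := hnorm_triangle s y t; lra.
Qed.

Lemma closed_span_trans (w v : nat -> H) y :
  (forall i, closed_span w (v i)) -> closed_span v y -> closed_span w y.
Proof.
move=> wv /closed_spanP vy; apply: closed_span_closed => e /vy[s [n [c ->]] hs].
exists (\sum_(i < n) c i *: v i) => //.
elim: n {hs} => [|n IH]; first by rewrite big_ord0; exact/span_closed_span/span0.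
by rewrite big_ord_recr /= addrC; exact: closed_span_lin.
Qed.

(* Orthonormal up to zero vectors, so that a linearly dependent family can be
   orthonormalised without discarding indices. *)
Definition orthosystem (e : nat -> H) :=
  (forall i j, i != j -> ip (e i) (e j) = 0) /\ (forall i, e i = 0 \/ ip (e i) (e i) = 1).

(** * Fourier sums and diagonal operators *)

Section Orthosystem.
Variable e : nat -> H.
Hypothesis orth : orthosystem e.

Lemma ortho_coef x i : ip x (e i) * ip (e i) (e i) = ip x (e i).
Proof. by case: orth => _ /(_ i)[->|->]; rewrite ?ip0r ?mul0r ?mulr1. Qed.

Lemma ortho_norm_le1 i : N (e i) <= 1.
Proof.
case: orth => _ /(_ i)[->|e1]; first by rewrite hnorm0.
by rewrite /hnorm e1 sqrtr1.
Qed.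

Lemma ip_sum_ortho (a : nat -> R[i]) n k : ip (\sum_(i < n) a i *: e i) (e k)
  = if (k < n)%N then a k * ip (e k) (e k) else 0.
Proof.
elim: n => [|n IH]; first by rewrite big_ord0 ip0l.
rewrite big_ord_recr /= ipDl IH ipZl ltnS (leq_eqVlt k n).
have [->|kn] := eqVneq k n; first by rewrite ltnn add0r.
case: orth => /(_ n k) en _; by rewrite en 1?eq_sym // mulr0 addr0.
Qed.

Lemma sum_ortho_sqr (a : nat -> R[i]) n :
  N (\sum_(i < n) a i *: e i) ^+ 2 = \sum_(i < n) (cabs (a i) * N (e i)) ^+ 2.
Proof.
elim: n => [|n IH]; first by rewrite !big_ord0 hnorm0 expr0n.
by rewrite !big_ord_recr /= hnormD_sqr IH hnormZ ipZr ip_sum_ortho ltnn mulr0 /= mulr0 addr0.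
Qed.

(** Partial sums of the diagonal operator with eigenvalues [mu]; the constant [mu] = 1 gives the
    usual Fourier sums. *)
Definition fourier (mu : nat -> R[i]) n x := \sum_(i < n) (mu i * ip x (e i)) *: e i.

Lemma fourier_sqr mu n x :
  N (fourier mu n x) ^+ 2 = \sum_(i < n) (cabs (mu i) * cabs (ip x (e i))) ^+ 2.
Proof.
rewrite /fourier (sum_ortho_sqr (fun i => mu i * ip x (e i))); apply: eq_bigr => i _.
rewrite cabsM -mulrA; congr ((_ * _) ^+ 2).
case: orth => _ /(_ i)[->|e1]; first by rewrite ip0r ComplexField.Normc.normc0 mul0r.
by rewrite /hnorm e1 sqrtr1 mulr1.
Qed.

Lemma bessel n x : \sum_(i < n) cabs (ip x (e i)) ^+ 2 <= N x ^+ 2.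
Proof.
rewrite -subr_ge0; have := sqr_ge0 (N (x - fourier (fun=> 1) n x)).
rewrite hnormB_sqr fourier_sqr ComplexField.Normc.normc1.
under eq_bigr do rewrite mul1r.
have -> : ip x (fourier (fun=> 1) n x) = (\sum_(i < n) cabs (ip x (e i)) ^+ 2)%:C.
  rewrite /fourier ip_sumr rmorph_sum; apply: eq_bigr => i _.
  by rewrite mul1r ipZr mulrC mulc_conj.
rewrite /=; lra.
Qed.

(** By Pythagoras the squared distance of two partial sums is at most the difference of the sums
    [t], which increase to a finite supremum. *)
Lemma riesz_fischer (a : nat -> R[i]) (M : R) :
  (forall n, \sum_(i < n) cabs (a i) ^+ 2 <= M) ->
  exists l, hcvg (fun n => \sum_(i < n) a i *: e i) l.
Proof.
move=> aM; pose s n := \sum_(i < n) a i *: e i.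
pose t n := \sum_(i < n) cabs (a i) ^+ 2.
have dist n k : N (s (n + k)%N - s n) ^+ 2 <= t (n + k)%N - t n.
  elim: k => [|k IH]; first by rewrite addn0 !subrr hnorm0 expr0n.
  rewrite addnS /s /t !big_ord_recr /= -/(s _) -/(s _) -/(t _) -/(t _) addrAC hnormD_sqr.
  rewrite ipZr ipDl ipNl !ip_sum_ortho ltnn ltnNge leq_addr /= subrr mulr0 /= mulr0 addr0.
  rewrite addrAC lerD // hnormZ ler_sqr ?nnegrE ?mulr_ge0 ?cabs_ge0 //.
  by rewrite ler_piMr ?cabs_ge0 ?ortho_norm_le1.
pose E : set R := [set t n | n in setT]%classic.
have hE : has_sup E.
  split; first by exists (t 0), 0%N.
  by exists M => _ [n _ <-]; exact: aM.
apply: complete => d d0; have d2 : 0 < (d / 2) ^+ 2 by rewrite exprn_gt0 // divr_gt0.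
have [_ [n0 _ <-] hn0] := sup_adherent d2 hE.
have small n : (n0 <= n)%N -> N (s n - s n0) < d / 2.
  move=> n0n; rewrite -(ltr_pXn2r (n := 2)) ?nnegrE ?divr_ge0 ?(ltW d0) //.
  rewrite -(subnKC n0n); apply: (le_lt_trans (dist _ _)); rewrite ltrBlDr addrC -ltrBlDr.
  by apply: le_lt_trans hn0; rewrite lerD2r; apply: ub_le_sup; [case: hE|eexists].
exists n0 => m n /small hm /small hn.
by have := hnorm_triangle (s n0) (s m) (s n); rewrite (hnormBC (s n0)) /s; lra.
Qed.

Lemma ortho_dist_le z (b : nat -> R[i]) n : (forall i, (i < n)%N -> ip z (e i) = 0) ->
  N z <= N (z + \sum_(i < n) b i *: e i).
Proof.
move=> z0; have h : ip z (\sum_(i < n) b i *: e i) = 0.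
  by rewrite ip_sumr big1 // => i _; rewrite ipZr z0 ?mulr0.
by rewrite -(ler_pXn2r (n := 2)) ?nnegrE // hnormD_sqr h /= mulr0 addr0 lerDl sqr_ge0.
Qed.

(** Among combinations of the first m vectors the Fourier sum is nearest to [y], so it is at least
    as good as any approximant given by the closed span. *)
Lemma fourier_cvg y : closed_span e y -> hcvg (fun n => fourier (fun=> 1) n y) y.
Proof.
move=> /closed_spanP ye d /ye[_ [n [c ->]] hs]; exists n => m nm.
apply: le_lt_trans hs; rewrite (sum_pad e c nm) hnormBC.
set c' := fun i => if (i < n)%N then c i else 0.
have -> : y - \sum_(i < m) c' i *: e i
  = y - fourier (fun=> 1) m y + \sum_(i < m) (ip y (e i) - c' i) *: e i.
  rewrite -addrA; congr (_ + _); rewrite /fourier -!sumrN -big_split; apply: eq_bigr => i _ /=.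
  by rewrite mul1r scalerBl addrA addNr add0r.
apply: (ortho_dist_le (fun i => ip y (e i) - c' i)) => i im.
by rewrite ipDl ipNl (ip_sum_ortho (fun i => 1 * ip y (e i))) im mul1r ortho_coef subrr.
Qed.

Hypothesis total : forall y, closed_span e y.

(** Bessel and Riesz-Fischer make the weighted Fourier sums converge. The conjugate weights give the
    adjoint, and totality makes the two operators inverse to each other. *)
Lemma diagonal_unitary (mu : nat -> R[i]) : (forall i, cabs (mu i) = 1) ->
  exists2 V, unitary ip V & forall i, V (e i) = mu i *: e i.
Proof.
have limits nu x : (forall i, cabs (nu i) = 1) -> exists l, hcvg (fun n => fourier nu n x) l.
  move=> nu1; apply: (@riesz_fischer (fun i => nu i * ip x (e i)) (N x ^+ 2)) => n.
  under eq_bigr do rewrite cabsM nu1 mul1r.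
  exact: bessel.
have diag nu : (forall i, cabs (nu i) = 1) -> exists D : {linear H -> H},
    (forall x, hcvg (fun n => fourier nu n x) (D x)) /\ forall i, D (e i) = nu i *: e i.
  move=> nu1; have [D DP] := choice (fun x => limits nu x nu1).
  have linD : linear_op D.
    move=> a x y; apply: (hcvg_unique (DP _)).
    apply: eq_hcvg (hcvgD (hcvgZ a (DP x)) (DP y)) => n.
    rewrite /fourier scaler_sumr -big_split; apply: eq_bigr => i _ /=.
    by rewrite !ipE scalerA -scalerDl; congr (_ *: _); ring.
  exists (lin_of linD); split=> // i /=; apply: (hcvg_unique (DP _)) => d d0.
  exists i.+1 => n ni; have -> : fourier nu n (e i) = nu i *: e i.
    rewrite /fourier (bigD1 (Ordinal ni)) //= big1 ?addr0.
      case: orth => _ /(_ i)[->|->]; by rewrite ?scaler0 ?mulr1.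
    move=> j ji; have ij : i != j.
      by apply: contra ji => /eqP ij; apply/eqP/val_inj; rewrite /= ij.
    by case: orth => /(_ i j ij) -> _; rewrite mulr0 scale0r.
  by rewrite subrr hnorm0.
move=> mu1; have mu1' i : cabs (conjc (mu i)) = 1 by rewrite cabs_conj.
have [D [DP De]] := diag mu mu1; have [D' [DP' De']] := diag (fun i => conjc (mu i)) mu1'.
have adj x y : ip (D x) y = ip x (D' y).
  apply: (ip_eq_limit (DP x) (DP' y)) => n; rewrite ip_suml ip_sumr.
  by apply: eq_bigr => i _; rewrite ipZl ipZr conjcM conjcK -ipC; ring.
have adj' x y : ip (D' x) y = ip x (D y) by rewrite ipC -adj -ipC.
have mumu i : mu i * conjc (mu i) = 1 by rewrite mulc_conj mu1 expr1n.
have D'D x : D' (D x) = x.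
  apply: (hcvg_unique (DP' _)); apply: eq_hcvg (fourier_cvg (total x)) => n.
  apply: eq_bigr => i _; congr (_ *: _).
  by rewrite adj De' ipZr conjcK mulrA (mulrC (conjc _)) mumu.
have DD' x : D (D' x) = x.
  apply: (hcvg_unique (DP _)); apply: eq_hcvg (fourier_cvg (total x)) => n.
  apply: eq_bigr => i _; congr (_ *: _).
  by rewrite adj' De ipZr mulrA mumu.
exists D => //; split.
- by move=> a x y; rewrite linearP.
- by exists 1 => x; rewrite mul1r /hnorm adj D'D.
- by exists D'.
Qed.

(** The bound [K] only provides continuity, so that [T x] is the limit of its values on Fourier
    sums; there the eigenvalues give the bound [c]. *)
Lemma diagonal_norm_le (T : {linear H -> H}) (tau : nat -> R[i]) (K c : R) :
  (forall x, N (T x) <= K * N x) -> 0 <= c ->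
  (forall i, T (e i) = tau i *: e i) -> (forall i, cabs (tau i) <= c) ->
  forall x, N (T x) <= c * N x.
Proof.
move=> TK c0 Te tauc x.
have TL y z : N (T y - T z) <= K * N (y - z) by rewrite -linearB.
apply: (hcvg_norm_le (hcvg_lipschitz TL (fourier_cvg (total x)))) => n.
have -> : T (fourier (fun=> 1) n x) = fourier tau n x.
  rewrite linear_sum; apply: eq_bigr => i _.
  by rewrite linearZ /= Te scalerA mul1r mulrC.
rewrite -(ler_pXn2r (n := 2)) ?nnegrE ?mulr_ge0 // fourier_sqr exprMn.
apply: (@le_trans _ _ (c ^+ 2 * \sum_(i < n) cabs (ip x (e i)) ^+ 2)).
  rewrite mulr_sumr; apply: ler_sum => i _; rewrite -exprMn ler_sqr ?nnegrE ?mulr_ge0 ?cabs_ge0 //.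
  by rewrite ler_wpM2r ?cabs_ge0.
by rewrite ler_wpM2l ?sqr_ge0 ?bessel.
Qed.

End Orthosystem.

(** * Gram-Schmidt orthonormalisation of eigenvectors *)

Definition normalise (x : H) : H := ((N x)^-1)%:C *: x.

Lemma normaliseK x : (N x)%:C *: normalise x = x.
Proof.
have [x0|xn0] := eqVneq (N x) 0; first by rewrite (hnorm_eq0 x0) /normalise !scaler0.
by rewrite scalerA -rmorphM /= divff // scale1r.
Qed.

(** The inverse of 0 is 0, so the zero vector normalises to itself. *)
Lemma normalise_unit x : normalise x = 0 \/ ip (normalise x) (normalise x) = 1.
Proof.
have [x0|xn0] := eqVneq (N x) 0; [left|right].
  by rewrite (hnorm_eq0 x0) /normalise scaler0.
by rewrite ipxx hnormZr ger0_norm ?invr_ge0 // mulVf // expr1n.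
Qed.

Section GramSchmidt.
Variables (C C' : {linear H -> H}) (v : nat -> H) (c : nat -> R[i]).
Hypotheses (adjC : forall x y, ip (C x) y = ip x (C' y))
           (eigv : forall k, eigen C C' (c k) (v k)).

Lemma eigen_lin a b x y : eigen C C' b x -> eigen C C' b y -> eigen C C' b (a *: x + y).
Proof.
move=> [Cx Cx'] [Cy Cy']; split; rewrite linearP ?Cx ?Cx' ?Cy ?Cy' scalerDr !scalerA;
by rewrite mulrC.
Qed.

Lemma eigen0 b : eigen C C' b 0.
Proof. by split; rewrite linear0 scaler0. Qed.

(** Accumulating the earlier vectors in a list makes the recursion structural; [gsE] recovers the
    usual formula. *)
Fixpoint gs_list n : seq H :=
  if n is k.+1 then
    rcons (gs_list k) (normalise (v k - \sum_(u <- gs_list k) ip (v k) u *: u))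
  else [::].

Definition gs k := normalise (v k - \sum_(u <- gs_list k) ip (v k) u *: u).

Lemma gsE k : gs k = normalise (v k - \sum_(i < k) ip (v k) (gs i) *: gs i).
Proof.
have -> : \sum_(i < k) ip (v k) (gs i) *: gs i = \sum_(u <- gs_list k) ip (v k) u *: u => //.
have -> : gs_list k = mkseq gs k.
  by elim: k => [|k IH] //; rewrite mkseqS -IH.
by rewrite big_map -(big_mkord xpredT (fun i => ip (v k) (gs i) *: gs i)) /index_iota subn0.
Qed.

Lemma gs_orthosystem : orthosystem gs.
Proof.
have unit i : gs i = 0 \/ ip (gs i) (gs i) = 1 by exact: normalise_unit.
suff lt_orth k i : (i < k)%N -> ip (gs k) (gs i) = 0.
  split=> // i j; rewrite neq_ltn => /orP[ij|/lt_orth //].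
  by rewrite ipC lt_orth // conjc0.
elim/ltn_ind: k i => k IH i ik.
suff key : ip (v k - \sum_(j < k) ip (v k) (gs j) *: gs j) (gs i) = 0.
  by rewrite {1}gsE ipZl key mulr0.
rewrite ipDl ipNl ip_suml (bigD1 (Ordinal ik)) //= big1 ?addr0.
  by rewrite ipZl; case: (unit i) => [->|->]; rewrite ?ip0r ?mulr1 ?mulr0 subrr.
move=> j ji; have : (j != i :> nat) by apply: contra ji => /eqP ji; apply/eqP/val_inj.
rewrite neq_ltn ipZl => /orP[lt_ji|/IH ->]; rewrite ?mulr0 //.
by rewrite (ipC (gs i)) IH // conjc0 mulr0.
Qed.

(** Projections onto earlier vectors with another eigenvalue vanish by orthogonality, so [v k] is
    corrected only within its own eigenspace. *)
Lemma gs_eigen k : eigen C C' (c k) (gs k).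
Proof.
elim/ltn_ind: k => k IH; rewrite gsE /normalise -[_ *: _]addr0.
apply: eigen_lin; last exact: eigen0.
rewrite addrC -scaleN1r; apply: eigen_lin; last exact: eigv.
apply: big_ind => [|x y ex ey|i _]; first exact: eigen0.
  by rewrite -[x]scale1r; exact: eigen_lin.
have [cik|cik] := eqVneq (c k) (c i).
  rewrite -[_ *: _]addr0; apply: eigen_lin; last exact: eigen0.
  by rewrite cik; exact: IH.
by rewrite (eigen_orthogonal adjC (eigv k) (IH i _) cik) // scale0r; exact: eigen0.
Qed.

Lemma gs_span k : span gs (v k).
Proof.
have <- : (N (v k - \sum_(i < k) ip (v k) (gs i) *: gs i))%:C *: gs k
  + \sum_(i < k) ip (v k) (gs i) *: gs i = v k by rewrite gsE normaliseK subrK.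
apply: span_lin; first exact: span_gen.
by exists k, (fun i => ip (v k) (gs i)).
Qed.

End GramSchmidt.

(** * Cyclicity of diagonal operators with distinct eigenvalues *)

Section Cyclic.
Variables (e : nat -> H) (mu : nat -> R[i]) (V : {linear H -> H}).
Hypotheses (orth : orthosystem e) (total : forall y, closed_span e y)
  (isoV : forall x, N (V x) = N x) (Ve : forall i, V (e i) = mu i *: e i)
  (mu1 : forall i, cabs (mu i) = 1) (mu_inj : injective mu).

Definition ergodic_avg (W : H -> H) n x : H := (n.+1%:R^-1)%:C *: \sum_(i < n.+1) iter i W x.

Lemma ergodic_avg_le (W : H -> H) n x : (forall y, N (W y) = N y) -> N (ergodic_avg W n x) <= N x.
Proof.
move=> isoW; rewrite hnormZr ger0_norm ?invr_ge0 ?ler0n // mulrC ler_pdivrMr ?ltr0n //.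
apply: (le_trans (hnorm_sum _ _ _)).
rewrite (eq_bigr (fun=> N x)) => [|i _]; last by elim: (i : nat) => //= k; rewrite isoW.
by rewrite sumr_const card_ord mulr_natr.
Qed.

(** The sum telescopes to [z - iter n.+1 W z], of norm at most [2 * N z]. *)
Lemma ergodic_avg_coboundary (W : {linear H -> H}) n z : (forall y, N (W y) = N y) ->
  N (ergodic_avg W n (z - W z)) <= 2 * N z * n.+1%:R^-1.
Proof.
move=> isoW; have iso k : N (iter k W z) = N z by elim: k => //= k <-; rewrite isoW.
have -> : ergodic_avg W n (z - W z) = (n.+1%:R^-1)%:C *: (z - iter n.+1 W z).
  congr (_ *: _); elim: n.+1 => [|k IH]; first by rewrite big_ord0 subrr.
  rewrite big_ord_recr IH /=; have -> : iter k W (z - W z) = iter k W z - W (iter k W z).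
    by elim: k {IH} => //= k ->; rewrite linearB.
  by rewrite addrA subrK.
rewrite hnormZr ger0_norm ?invr_ge0 ?ler0n // mulrC ler_wpM2r ?invr_ge0 ?ler0n //.
by apply: (le_trans (hnormB _ _)); rewrite iso mulr_natl.
Qed.

Lemma diagonal_cyclic : cyclic_op ip V.
Proof.
pose a i : R := 2^-1 ^+ i.
have a0 i : 0 < a i by rewrite exprn_gt0 ?invr_gt0.
have [x cvx] : exists x, hcvg (fun n => \sum_(i < n) (a i)%:C *: e i) x.
  apply: (riesz_fischer orth (a := fun i => (a i)%:C) (M := 2)) => n.
  under eq_bigr do rewrite cabs_real ger0_norm ?(ltW (a0 _)) //.
  suff : \sum_(i < n) a i ^+ 2 <= 2 - 2 * a n by have := a0 n; lra.
  elim: n => [|n IH]; first by rewrite big_ord0 /a expr0 mulr1 subrr.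
  rewrite big_ord_recr /=.
  have : a n <= 1 by rewrite exprn_ile1 // ?invr_ge0 // invf_le1 // ler1n.
  rewrite [a n.+1]exprS -/(a n); move: (a0 n) IH; move: (a n) (\sum_(i < n) _) => t s.
  nra.
exists x => y; rewrite -/(closed_span (fun i => iter i V x) y).
apply: (closed_span_trans _ (total y)) => m; apply/closed_spanP => d d0.
have [em|em] := eqVneq (e m) 0.
  by exists 0; [exact: span0|rewrite em subr0 hnorm0].
(* [W] fixes [e m] and acts on every other nonzero [e i] by a unit number different from 1; its
   averages therefore isolate [e m]. *)
have [W WE] : exists W : {linear H -> H}, forall z, W z = conjc (mu m) *: V z.
  by exists (conjc (mu m) \*: V).
have isoW z : N (W z) = N z by rewrite WE hnormZ cabs_conj mu1 mul1r isoV.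
have mumu i : conjc (mu i) * mu i = 1 by rewrite mulrC mulc_conj mu1 expr1n.
have We i : W (e i) = (conjc (mu m) * mu i) *: e i by rewrite WE Ve scalerA.
(* Half of the budget [a m * d] goes to the tail beyond [K], half to the averaged coboundary;
   dividing by [a m] at the end leaves [d]. *)
have d1 : 0 < a m * d / 2 by rewrite divr_gt0 // mulr_gt0.
have [K0 hK0] := cvx _ d1; pose K := maxn K0 m.+1.
(* [b] drops the coefficient at [m]; there the quotient in [z] is 0/0 = 0, and elsewhere distinct
   eigenvalues keep the denominator nonzero. Thus [z] solves the coboundary equation [zW]. *)
pose b i := if i == m then 0 else (a i)%:C.
pose z := \sum_(i < K) (b i / (1 - conjc (mu m) * mu i)) *: e i.
have zW : z - W z = \sum_(i < K) b i *: e i.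
  rewrite linear_sum -sumrB; apply: eq_bigr => i _ /=.
  rewrite [W (_ *: _)]linearZ /= We scalerA -scalerBl -[X in X - _]mulr1 -mulrBr /b.
  case: eqP => [|/eqP im]; first by rewrite !mul0r.
  rewrite divfK // subr_eq0; apply: contra im => /eqP h; apply/eqP/mu_inj.
  by rewrite -[RHS]mulr1 h mulrA (mulrC (mu m)) mumu mul1r.
have sK : \sum_(i < K) (a i)%:C *: e i = (a m)%:C *: e m + (z - W z).
  have mK : (m < K)%N by rewrite leq_maxr.
  rewrite zW (bigD1 (Ordinal mK)) //=; congr (_ + _).
  rewrite [RHS](bigD1 (Ordinal mK)) //= /b eqxx scale0r add0r; apply: eq_bigr => i im.
  by rewrite -[(i : nat) == m]/(i == Ordinal mK) (negPf im).
(* The added 1 keeps the divisor [2 * N z + 1] positive even when [z] vanishes. *)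
have [n hn] := inv_nat_small (divr_gt0 d1 (ltr_wpDl (mulr_ge0 (ler0n R 2) (hnorm_ge0 z)) ltr01)).
exists ((a m)^-1%:C *: ergodic_avg W n x).
  rewrite -[_ *: _]addr0; apply: span_lin; last exact: span0.
  rewrite -[ergodic_avg _ _ _]addr0; apply: span_lin; last exact: span0.
  have -> : \sum_(i < n.+1) iter i W x
    = \sum_(i < n.+1) (conjc (mu m) ^+ i) *: iter i V x.
    apply: eq_bigr => i _; elim: (i : nat) => [|k IH]; first by rewrite scale1r.
    by rewrite !iterS IH WE linearZ /= scalerA -exprS.
  by exists n.+1, (fun i => conjc (mu m) ^+ i).
have avgD u w : ergodic_avg W n (u + w) = ergodic_avg W n u + ergodic_avg W n w.
  rewrite -scalerDr -big_split; congr (_ *: _); apply: eq_bigr => i _ /=.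
  by elim: (i : nat) => //= k ->; rewrite linearD.
have avgm : ergodic_avg W n ((a m)%:C *: e m) = (a m)%:C *: e m.
  rewrite /ergodic_avg (eq_bigr (fun=> (a m)%:C *: e m)) => [|i _]; last first.
    by elim: (i : nat) => //= k ->; rewrite linearZ /= We mumu scale1r.
  rewrite sumr_const card_ord -scaler_nat scalerA -(rmorph_nat (real_complex R)).
  by rewrite -rmorphM /= mulVf ?pnatr_eq0 // scale1r.
(* Averaging fixes the first summand, makes the coboundary small and does not enlarge the tail. *)
have -> : x = (a m)%:C *: e m + ((z - W z) + (x - \sum_(i < K) (a i)%:C *: e i)).
  by rewrite addrA -sK addrC subrK.
rewrite avgD avgm avgD scalerDr scalerA -rmorphM /= mulVf ?gt_eqF // scale1r.
rewrite opprD addrA subrr add0r hnormN hnormZr gtr0_norm ?invr_gt0 //.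
rewrite mulrC ltr_pdivrMr // (mulrC d).
apply: (le_lt_trans (hnormD _ _)).
have h1 := ergodic_avg_coboundary n z isoW.
have h2 := ergodic_avg_le n (x - \sum_(i < K) (a i)%:C *: e i) isoW.
have h3 := hK0 K (leq_maxl _ _); rewrite hnormBC in h3.
move: hn; rewrite ltr_pdivlMr; last by rewrite ltr_wpDl // mulr_ge0.
have : 0 < n.+1%:R^-1 :> R by rewrite invr_gt0 ltr0n.
move: h1 h2 h3; move: (n.+1%:R^-1) (a m * d) (N z) (N _) (N _) (N _) => p q r s t u; nra.
Qed.

End Cyclic.

End InnerProduct.

(** * Distinct unit numbers near given ones *)

Lemma unit_avoid (R : realType) (lam : R[i]) (d : R) (L : seq R[i]) :
  cabs lam = 1 -> 0 < d ->
  exists mu, [/\ cabs mu = 1, cabs (lam - mu) <= d & mu \notin L].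
Proof.
move=> lam1 d0; pose h : R := Num.min 1 (d / 2).
have h0 : 0 < h by rewrite lt_min ltr01 divr_gt0.
have h1 : h <= 1 by rewrite ge_min lexx.
have h2 : h <= d / 2 by rewrite ge_min lexx orbT.
pose t m : R := h * m.+1%:R^-1.
have t0 m : 0 < t m by rewrite mulr_gt0 // invr_gt0 ltr0n.
have th m : t m <= h by rewrite ler_piMr ?(ltW h0) // invf_le1 ?ltr0n // ler1n.
(* Infinitely many distinct rotations close to 1, determined by their imaginary parts [t m]. *)
pose z m : R[i] := Complex (Num.sqrt (1 - t m ^+ 2)) (t m).
have t1 m : 0 <= 1 - t m ^+ 2 by have := t0 m; have := th m; nra.
have z1 m : cabs (z m) = 1 by rewrite /= sqr_sqrtr // subrK sqrtr1.
have z_inj : injective z.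
  move=> m n [_ /(mulfI (lt0r_neq0 h0))/invr_inj/eqP].
  by rewrite eqr_nat eqSS => /eqP.
have lam0 : lam != 0 by rewrite -cabs_eq0 lam1 oner_eq0.
have near m : cabs (lam - lam * z m) <= d.
  rewrite -[X in X - _]mulr1 -mulrBr cabsM lam1 mul1r.
  have [s [s0 su sE]] : exists s : R, [/\ 0 <= s, s ^+ 2 = 1 - t m ^+ 2 & z m = Complex s (t m)].
    by exists (Num.sqrt (1 - t m ^+ 2)); rewrite sqrtr_ge0 sqr_sqrtr.
  rewrite -(ler_pXn2r (n := 2)) ?nnegrE ?cabs_ge0 ?(ltW d0) // cabs_sqr sE /=.
  have := t0 m; have := le_trans (th m) h2; move: (t m) su {sE} => u su ud u0.
  have s1 : s <= 1 by case: (leP s 1) => // ?; have := sqr_ge0 u; nra.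
  have : 0 <= (d / 2 - u) * (d / 2 + u) by apply: mulr_ge0; lra.
  (* As s^2 <= s, the squared modulus of 1 - z is 2 - 2 s <= 2 u^2 <= d^2/2. *)
  have : 0 <= s * (1 - s) by apply: mulr_ge0; lra.
  have := sqr_ge0 d; nra.
have [m mL] : exists m, lam * z m \notin L.
  (* Pigeonhole: [size L + 1] distinct rotated values cannot all lie in [L]. *)
  apply: contrapT => /forallNP noL.
  pose s := [seq lam * z m | m <- iota 0 (size L).+1].
  have : (size s <= size L)%N.
    apply: uniq_leq_size.
      by rewrite map_inj_uniq ?iota_uniq // => i j /(mulfI lam0)/z_inj.
    by move=> _ /mapP[i _ ->]; have /negP := noL i; rewrite negbK.
  by rewrite size_map size_iota ltnn.
by exists (lam * z m); split=> //; rewrite cabsM lam1 z1 mulr1.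
Qed.

(** Greedy choice: [l k] lists the numbers chosen before stage [k], and each new one avoids that
    list. *)
Lemma distinct_units (R : realType) (lam : nat -> R[i]) (d : R) :
  (forall i, cabs (lam i) = 1) -> 0 < d ->
  exists mu, [/\ forall i, cabs (mu i) = 1, forall i, cabs (lam i - mu i) <= d & injective mu].
Proof.
move=> lam1 d0.
have [pick pickP] := choice (fun p : nat * seq R[i] => unit_avoid p.2 (lam1 p.1) d0).
pose l := fix l n := if n is k.+1 then pick (k, l k) :: l k else [::].
pose mu k := pick (k, l k).
have mu_l i k : (i < k)%N -> mu i \in l k.
  elim: k => // k IH; rewrite ltnS leq_eqVlt in_cons => /orP[/eqP ->|/IH ->].
    by rewrite eqxx.
  by rewrite orbT.
have neq i k : (i < k)%N -> mu i != mu k.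
  by move=> /mu_l il; have [_ _ nl] := pickP (k, l k); apply: contraNneq nl => ik;
    rewrite -/(mu k) -ik.
exists mu; split=> [i|i|i j /eqP]; [by case: (pickP (i, l i))..|].
by apply: contraTeq; rewrite neq_ltn => /orP[/neq|/neq]; rewrite 1?eq_sym.
Qed.

(** * Diagonalising the approximation and perturbing its eigenvalues *)

Theorem theorem4 (R : realType) (H : lmodType R[i]) (ip : H -> H -> R[i]) :
  hilbert_space ip -> separable_space ip -> infinite_dimensional H ->
  forall U : H -> H, unitary ip U ->
  forall e : R, 0 < e ->
  exists V : H -> H,
    [/\ unitary ip V, cyclic_op ip V & opnorm_lt ip (fun x => U x - V x) e].
Proof.
move=> [ipax complete] [d d_dense] _ U unitU e e0.
pose h : R := Num.min (e / 4) 2^-1.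
have h0 : 0 < h by rewrite lt_min; apply/andP; split; lra.
have he : h <= e / 4 by rewrite ge_min lexx.
have h1 : h <= 2^-1 by rewrite ge_min lexx orbT.
have [C [C' [adjC nearC decomp]]] := unitary_diagonal_approx ipax complete unitU h0.
have [l dl lP] : exists2 l : nat -> seq H, forall n, d n = \sum_(v <- l n) v &
    forall n v, v \in l n -> exists c, eigen C C' c v.
  have ex n : exists l : seq H, d n = \sum_(v <- l) v /\
      forall v, v \in l -> exists c, eigen C C' c v.
    by have [l] := decomp (d n); exists l.
  by have [l lP] := choice ex; exists l => n; case: (lP n).
(* Lists the eigenvectors from the decompositions of all [d n] in one sequence, with 0 as filler for
   codes that name no entry. *)
pose v k := if unpickle k is Some p then nth 0 (l p.1) p.2 else 0.
have eigv k : exists c, eigen C C' c (v k).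
  rewrite /v; case: (unpickle k) => [[n i]|]; last by exists 0; exact: eigen0.
  have [ilt|ige] := ltnP i (size (l n)); first by apply: (lP n); exact: mem_nth.
  by exists 0; rewrite nth_default //; exact: eigen0.
have [c cP] := choice eigv.
pose g := gs ip v.
have orth : orthosystem ip g := gs_orthosystem ipax v.
have eigg k : eigen C C' (c k) (g k) := gs_eigen ipax adjC cP k.
have total y : closed_span ip g y.
  apply: (closed_span_trans ipax (v := v)) => [k|].
    by apply: (span_closed_span ipax); exact: (gs_span ipax).
  apply: (closed_span_closed ipax) => r /(d_dense y)[n hn]; exists (d n) => //.
  apply: (span_closed_span ipax); rewrite dl (big_nth 0).
  under eq_bigr do rewrite -[nth _ _ _]scale1r.
  apply: span_sum => i; have -> : nth 0 (l n) i = v (pickle (n, i)) by rewrite /v pickleK.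
  exact: span_gen.
have [linU _ [U' [adjU U'U _]]] := unitU.
have isoU x : hnorm ip (U x) = hnorm ip x by rewrite /hnorm adjU U'U.
(* [p.2] is an eigenvalue of [C] at [g k] and [p.1] a unit number near it; where [g k] is zero any
   eigenvalue serves, and both are set to 1. *)
have near_unit k : exists p : R[i] * R[i],
    [/\ cabs p.1 = 1, C (g k) = p.2 *: g k & cabs (p.2 - p.1) <= h].
  have [Cg _] := eigg k; have [_ /(_ k)[g0|g1]] := orth.
    exists (1, 1); split; [exact: ComplexField.Normc.normc1|by rewrite g0 linear0 scaler0|].
    by rewrite [X in cabs X]subrr ComplexField.Normc.normc0 ltW.
  have Ng : hnorm ip (g k) = 1 by rewrite /hnorm g1 sqrtr1.
  have := nearC (g k); rewrite Cg Ng mulr1 => near.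
  have Nc : hnorm ip (c k *: g k) = cabs (c k) by rewrite hnormZ // Ng mulr1.
  have Ug := isoU (g k); rewrite Ng in Ug.
  (* As [U (g k)] has norm 1, two triangle inequalities place the modulus of [c k] within [h] of 1;
     [h <= 1/2] makes [c k] nonzero, so it can be normalised. *)
  have := hnormD ipax (U (g k) - c k *: g k) (c k *: g k); rewrite subrK Nc Ug => le1.
  have := hnormB ipax (U (g k)) (U (g k) - c k *: g k); rewrite subKr Nc Ug => le2.
  have ck0 : 0 < cabs (c k) by lra.
  exists (((cabs (c k))^-1)%:C * c k, c k); split=> //=.
    by rewrite cabsM cabs_real gtr0_norm ?invr_gt0 // mulVf ?gt_eqF.
  rewrite -[X in X - _]mul1r -mulrBl cabsM -(rmorph1 (real_complex R)) -rmorphB cabs_real.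
  rewrite -[X in _ * X](gtr0_norm ck0) -normrM mulrBl mul1r mulVf ?gt_eqF //.
  by rewrite ler_norml; apply/andP; split; lra.
have [p pP] := choice near_unit.
have p1 i : cabs (p i).1 = 1 by case: (pP i).
have [mu [mu1 mup mu_inj]] := distinct_units p1 h0.
have [V unitV Vg] := diagonal_unitary ipax complete orth total mu1.
have [linV _ [V' [adjV V'V _]]] := unitV.
have isoV x : hnorm ip (V x) = hnorm ip x by rewrite /hnorm adjV V'V.
exists V; split=> //.
  exact: (diagonal_cyclic ipax complete (V := lin_of linV) orth total isoV Vg mu1 mu_inj).
(* [h] accounts for U - C and [2 * h] for C - V; since [h <= e / 4], the total is below [e]. *)
exists (3 * h); split=> [|x]; first by lra.
have [T TE] : exists T : {linear H -> H}, forall x, T x = C x - V x.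
  by exists (C \- lin_of linV).
have NC y : hnorm ip (C y) <= (1 + h) * hnorm ip y.
  have := hnormB ipax (U y) (U y - C y); rewrite subKr isoU mulrDl mul1r.
  by have := nearC y; lra.
have TK y : hnorm ip (T y) <= (2 + h) * hnorm ip y.
  rewrite TE; have := hnormB ipax (C y) (V y); have := NC y; rewrite isoV; lra.
have h20 : 0 <= 2 * h by lra.
have Tg i : T (g i) = ((p i).2 - mu i) *: g i.
  by rewrite TE Vg; case: (pP i) => _ -> _; rewrite scalerBl.
(* One [h] is spent on normalising the eigenvalue, the other on making the unit numbers distinct. *)
have tau i : cabs ((p i).2 - mu i) <= 2 * h.
  rewrite -(subrKA (p i).1); apply: (le_trans (le_normcD _ _)).
  by have := mup i; case: (pP i) => _ _; lra.
have := diagonal_norm_le ipax orth total TK h20 Tg tau x.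
have := nearC x; have := hnorm_triangle ipax (C x) (U x) (V x); rewrite -TE.
have := hnorm_ge0 ip x; lra.
Qed.
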